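(* Let $P$ and $Q$ be two experimental designs, i.e. probability distributions on $\{0,1\}^n$, and suppose there is a constant $k_\tau$ such that $|\tau_i(\mathbf z)|\le k_\tau$ for all $i\in\{1,\dots,n\}$ and all $\mathbf z\in\{0,1\}^{n-1}$. Then, for any real $r\ge1$, $$\big|\tau_{P\text{-}EATE}-\tau_{Q\text{-}EATE}\big|\le 2k_\tau\, n^{-1/r}\,C_{r/(r-1)}\,W_r(P,Q),$$ where $C_{r/(r-1)}$ is read as $C_\infty$ when $r=1$.
   Context: There are $n$ units with arbitrary potential outcome functions $y_i:\{0,1\}^n\to\mathbb R$, $i=1,\dots,n$. For $\mathbf z\in\{0,1\}^n$, $\mathbf z_{-i}\in\{0,1\}^{n-1}$ is $\mathbf z$ with its $i$th entry deleted, and $y_i(\mathbf z)$ is also written $y_i(z_i;\mathbf z_{-i})$. Define $\tau_i(\mathbf z_{-i})=y_i(1;\mathbf z_{-i})-y_i(0;\mathbf z_{-i})$ and $\tau_{ATE}(\mathbf z)=\frac1n\sum_{i=1}^n\tau_i(\mathbf z_{-i})$. The expected average treatment effects under the two designs are $\tau_{P\text{-}EATE}=E_P[\tau_{ATE}(\mathbf Z)]$ and $\tau_{Q\text{-}EATE}=E_Q[\tau_{ATE}(\mathbf Z)]$. Interference. $I_{ij}=1$ if $i=j$ or if $y_j(\mathbf z)\ne y_j(\mathbf z')$ for some $\mathbf z,\mathbf z'\in\{0,1\}^n$ with $\mathbf z_{-i}=\mathbf z'_{-i}$; otherwise $I_{ij}=0$. Let $c_i=\sum_{j=1}^n I_{ij}$,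 $C_p=\big[\frac1n\sum_{i=1}^n c_i^p\big]^{1/p}$ for $1\le p<\infty$, and $C_\infty=\max_i c_i$. Wasserstein metric: $W_r(P,Q)=\inf_{J}E_J\big[\|\mathbf Z'-\mathbf Z''\|_r\big]$, where the infimum is over all joint distributions $J$ of $(\mathbf Z',\mathbf Z'')$ on $\{0,1\}^n\times\{0,1\}^n$ with marginals $P$ and $Q$, and $\|\mathbf x\|_r=(\sum_i|x_i|^r)^{1/r}$. *)

(* Defs.v *)
(* MathComp / MathComp-Analysis. *)
From HB Require Import structures.
From mathcomp Require Import all_boot all_order all_algebra.
From mathcomp Require Import classical_sets reals exp.

Set Implicit Arguments.
Unset Strict Implicit.
Unset Printing Implicit Defensive.
Import Order.TTheory GRing.Theory Num.Theory.
Local Open Scope classical_set_scope.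
Local Open Scope ring_scope.

(* A probability distribution on a finite set, given by its mass function. *)
Record distr (R : realType) (T : finType) := Distr {
  mass :> T -> R;
  mass_ge0 : forall x, 0 <= mass x;
  mass_sum1 : \sum_x mass x = 1 }.

Definition expect (R : realType) (T : finType) (P : distr R T) (f : T -> R) : R :=
  \sum_x P x * f x.

(* {0,1}^n, with [true] standing for 1. *)
Definition assignment (n : nat) : finType := {ffun 'I_n -> bool}.

(* z_{-i} *)
Definition delete (n : nat) (i : 'I_n) (z : assignment n) : assignment n.-1 :=
  [ffun k => z (lift i k)].

(* (b; w): the z with z_i = b and z_{-i} = w. *)
Definition insert (n : nat) (i : 'I_n) (b : bool) (w : assignment n.-1) :
    assignment n :=
  [ffun j => if unlift i j is Some k then w k else b].

Definition outcomes (R : realType) (n : nat) : Type := 'I_n -> assignment n -> R.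

Definition tau (R : realType) (n : nat) (y : outcomes R n) (i : 'I_n)
    (w : assignment n.-1) : R :=
  y i (insert i true w) - y i (insert i false w).

Definition tauATE (R : realType) (n : nat) (y : outcomes R n)
    (z : assignment n) : R :=
  n%:R^-1 * \sum_(i < n) tau y i (delete i z).

Definition tauEATE (R : realType) (n : nat) (y : outcomes R n)
    (P : distr R (assignment n)) : R :=
  expect P (tauATE y).

Definition interferes (R : realType) (n : nat) (y : outcomes R n)
    (i j : 'I_n) : bool :=
  (i == j) ||
  [exists z, exists z', (delete i z == delete i z') && (y j z != y j z')].

Definition outdeg (R : realType) (n : nat) (y : outcomes R n) (i : 'I_n) : nat :=
  (\sum_(j < n) interferes y i j)%N.

(* C_p for real p; the case p = +oo is [Cmax]. *)
Definition Cmean (R : realType) (n : nat) (y : outcomes R n) (p : R) : R :=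
  (n%:R^-1 * \sum_(i < n) (outdeg y i)%:R `^ p) `^ p^-1.

Definition Cmax (R : realType) (n : nat) (y : outcomes R n) : R :=
  (\max_(i < n) outdeg y i)%N%:R.

(* C_{r/(r-1)}. The case r = 1 is singled out since division by 0 yields 0. *)
Definition Cconj (R : realType) (n : nat) (y : outcomes R n) (r : R) : R :=
  if r == 1 then Cmax y else Cmean y (r / (r - 1)).

Definition lnorm (R : realType) (n : nat) (r : R) (x : 'I_n -> R) : R :=
  (\sum_(i < n) `|x i| `^ r) `^ r^-1.

Definition coupling (R : realType) (T : finType) (P Q : distr R T)
    (J : distr R (T * T)%type) : Prop :=
  (forall x, \sum_y J (x, y) = P x) /\ (forall y, \sum_x J (x, y) = Q y).

(* The infimum of a nonempty set of nonnegative reals: P x Q is a coupling. *)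
Definition Wasserstein (R : realType) (n : nat) (r : R)
    (P Q : distr R (assignment n)) : R :=
  inf [set w | exists2 J : distr R (assignment n * assignment n)%type,
    coupling P Q J &
    w = expect J (fun zz => lnorm r (fun i => (zz.1 i)%:R - (zz.2 i)%:R))].

(* Main.v *)
(* The map tauATE is Lipschitz for the r-norm. Flipping coordinates one at a
   time, tau_j changes only if some flipped unit interferes with j, and then by
   at most 2 ktau; summing over j, a flip of unit i costs at most
   2 ktau c_i / n, and Hoelder's inequality separates the c_i from the flips.
   Integrating the Lipschitz bound against a coupling of P and Q and taking the
   infimum over couplings concludes. *)
Require Import Defs.
From mathcomp Require Import all_boot all_order all_algebra.
From mathcomp Require Import classical_sets reals exp.
Import Order.TTheory GRing.Theory Num.Theory.
Local Open Scope ring_scope.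

Section FiniteHoelder.
Context {R : realType} {I : finType}.
Implicit Types (p q : R) (a b : I -> R).

Lemma psum_powR_eq0 p a : 0 < p -> \sum_i `|a i| `^ p = 0 -> forall i, a i = 0.
Proof.
move=> p0 /eqP; rewrite psumr_eq0 => [/allP a0 i|i _]; last exact: powR_ge0.
have /= := a0 i (mem_index_enum i).
by rewrite powR_eq0 normr_eq0 => /andP[/eqP].
Qed.

Lemma psum_powR_normalized p a (A := (\sum_i `|a i| `^ p) `^ p^-1) :
  0 < p -> A != 0 -> \sum_i (`|a i| / A) `^ p = 1.
Proof.
move=> p0 A0.
have Age0 : 0 <= A by exact: powR_ge0.
have S0 : \sum_i `|a i| `^ p != 0.
  (* The exponent [p^-1] is nonzero, so a zero sum would make [A] zero; at exponent 0 the power of 0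
     would be 1. *)
  by apply: contra_neq A0 => S0; rewrite /A S0 powR0 // invr_eq0 gt_eqF.
under eq_bigr do rewrite powRM ?invr_ge0 // -(powR_inv1 Age0) -powRrM.
rewrite -mulr_suml mulN1r powRN /A -powRrM mulVf ?gt_eqF // powRr1 ?mulfV //.
by apply: sumr_ge0 => i _; exact: powR_ge0.
Qed.

(** If one of the two norms is zero, that family vanishes and so does the left side. Otherwise both
    families are scaled to norm 1, and Young's inequality is applied index by index. *)
Lemma finite_hoelder p q a b : 0 < p -> 0 < q -> p^-1 + q^-1 = 1 ->
  \sum_i `|a i| * `|b i| <=
  (\sum_i `|a i| `^ p) `^ p^-1 * (\sum_i `|b i| `^ q) `^ q^-1.
Proof.
move=> p0 q0 pq.
set A := (\sum_i `|a i| `^ p) `^ p^-1; set B := (\sum_i `|b i| `^ q) `^ q^-1.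
have [A0|A0] := eqVneq A 0.
  have a0 := psum_powR_eq0 _ _ p0 (powR_eq0_eq0 A0).
  by rewrite A0 mul0r big1 // => i _; rewrite a0 normr0 mul0r.
have [B0|B0] := eqVneq B 0.
  have b0 := psum_powR_eq0 _ _ q0 (powR_eq0_eq0 B0).
  by rewrite B0 mulr0 big1 // => i _; rewrite b0 normr0 mulr0.
have Agt0 : 0 < A by rewrite lt_def A0 powR_ge0.
have Bgt0 : 0 < B by rewrite lt_def B0 powR_ge0.
have := psum_powR_normalized _ _ q0 B0; have := psum_powR_normalized _ _ p0 A0.
rewrite -/A -/B; move: A B Agt0 Bgt0 {A0 B0} => A B A0 B0 nA nB.
rewrite -[leRHS]mul1r -ler_pdivrMr ?mulr_gt0 // mulr_suml.
(* The bound 1 is spread over the indices as the sum of the right sides of Young's inequality. *)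
have <- : \sum_i ((`|a i| / A) `^ p / p + (`|b i| / B) `^ q / q) = 1.
  by rewrite big_split /= -!mulr_suml nA nB !mul1r.
apply: ler_sum => i _; rewrite invfM mulrACA.
by apply: conjugate_powR; rewrite // divr_ge0 // ltW.
Qed.

End FiniteHoelder.

Section Expectation.
Context {R : realType} {T : finType}.
Implicit Types P Q : distr R T.

Lemma expect_ge0 P (f : T -> R) : (forall x, 0 <= f x) -> 0 <= expect P f.
Proof. by move=> f0; apply: sumr_ge0 => x _; rewrite mulr_ge0 ?mass_ge0. Qed.

Lemma product_mass_ge0 P Q (x : T * T) : 0 <= P x.1 * Q x.2.
Proof. by rewrite mulr_ge0 ?mass_ge0. Qed.

Lemma product_mass_sum1 P Q : \sum_(x : T * T) P x.1 * Q x.2 = 1.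
Proof.
rewrite -(pair_bigA _ (fun x y => P x * Q y)) /= -(mass_sum1 P).
by apply: eq_bigr => x _; rewrite -mulr_sumr mass_sum1 mulr1.
Qed.

Definition product_distr P Q : distr R (T * T)%type :=
  Distr (product_mass_ge0 P Q) (product_mass_sum1 P Q).

Lemma product_coupling P Q : coupling P Q (product_distr P Q).
Proof.
by split=> x /=; rewrite -?mulr_suml -?mulr_sumr mass_sum1 ?mulr1 ?mul1r.
Qed.

(** Summing out either coordinate of [J] leaves the marginal [P] or [Q]. *)
Lemma coupling_expectB P Q J (f : T -> R) : coupling P Q J ->
  expect P f - expect Q f = expect J (fun zz => f zz.1 - f zz.2).
Proof.
move=> [JP JQ]; rewrite /expect.
rewrite (eq_bigr (fun zz => J (zz.1, zz.2) * f zz.1 - J (zz.1, zz.2) * f zz.2));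
  last by case=> x y _; rewrite mulrBr.
rewrite sumrB; congr (_ - _).
  rewrite -(pair_bigA _ (fun x y => J (x, y) * f x)) /=.
  by apply: eq_bigr => x _; rewrite -JP mulr_suml.
rewrite -(pair_bigA _ (fun x y => J (x, y) * f y)) exchange_big /=.
by apply: eq_bigr => x _; rewrite -JQ mulr_suml.
Qed.

Lemma coupling_lipschitz P Q J (f : T -> R) (d : T -> T -> R) (L : R) :
  coupling P Q J -> (forall x y, `|f x - f y| <= L * d x y) ->
  `|expect P f - expect Q f| <= L * expect J (fun zz => d zz.1 zz.2).
Proof.
move=> JPQ Lf; rewrite (coupling_expectB _ _ _ _ JPQ) /expect mulr_sumr.
apply: le_trans (ler_norm_sum _ _ _) _; apply: ler_sum => x _.
by rewrite normrM (ger0_norm (mass_ge0 J x)) mulrCA ler_wpM2l ?mass_ge0.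
Qed.

End Expectation.

Lemma Wasserstein_lipschitz (R : realType) (n : nat) (r L : R)
    (P Q : distr R (assignment n)) (f : assignment n -> R) :
  0 <= L ->
  (forall z z', `|f z - f z'| <= L * lnorm r (fun i => (z i)%:R - (z' i)%:R)) ->
  `|expect P f - expect Q f| <= L * Wasserstein r P Q.
Proof.
move=> L0 Lf.
have bound J (JPQ : coupling P Q J) := coupling_lipschitz _ _ _ _
  (fun z z' : assignment n => lnorm r (fun i => (z i)%:R - (z' i)%:R)) L JPQ Lf.
move: L0; rewrite le_eqVlt => /predU1P[L0|L0].
  (* For [L = 0] division by [L] is impossible, but a single coupling already bounds the difference
     by 0. *)
  by have := bound _ (product_coupling P Q); rewrite -L0 !mul0r.
rewrite mulrC -ler_pdivrMr //; apply: lb_le_inf.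
  (* A lower bound passes to [inf] only for a nonempty set; the product coupling provides a
     member. *)
  exists (expect (product_distr P Q)
    (fun zz => lnorm r (fun i => (zz.1 i)%:R - (zz.2 i)%:R))).
  by exists (product_distr P Q); first exact: product_coupling.
by move=> _ [J JPQ ->]; rewrite ler_pdivrMr // mulrC; exact: bound.
Qed.

Section Interference.
Context {R : realType} {n : nat}.
Variable y : outcomes R n.
Implicit Types (z : assignment n) (i j : 'I_n).

Lemma insert_delete i b z k :
  insert i b (delete i z) k = if k == i then b else z k.
Proof.
rewrite ffunE; case: unliftP => [m ->|->]; last by rewrite eqxx.
by rewrite ffunE eq_sym (negbTE (neq_lift _ _)).
Qed.

(* Telescoping along the hybrids that take their first k entries from z'. *)
Lemma outcome_eq j z z' :
  (forall i, interferes y i j -> z i = z' i) -> y j z = y j z'.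
Proof.
move=> zz'.
pose h k : assignment n := [ffun i : 'I_n => if (i < k)%N then z' i else z i].
have h0 : h 0%N = z by apply/ffunP => i; rewrite ffunE.
have hn : h n = z' by apply/ffunP => i; rewrite ffunE ltn_ord.
have step k : (k < n)%N -> y j (h k) = y j (h k.+1).
  move=> kn; pose i := Ordinal kn.
  have off m : m != i -> h k m = h k.+1 m.
    by rewrite !ffunE -(inj_eq val_inj) ltnS [in RHS]leq_eqVlt => /negbTE ->.
  have [Iij|] := boolP (interferes y i j).
    (* If [i] interferes with [j], then [z] and [z'] agree at [i] and consecutive hybrids coincide.
       Otherwise they differ at most at [i], which does not affect [y j]. *)
    congr (y j _); apply/ffunP => m.
    have [->|] := eqVneq m i; last exact: off.
    by rewrite !ffunE ltnn ltnSn zz'.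
  rewrite negb_or negb_exists => /andP[_ /forallP/(_ (h k))].
  rewrite negb_exists => /forallP/(_ (h k.+1)).
  have -> /= : delete i (h k) == delete i (h k.+1).
    by apply/eqP/ffunP => m; rewrite ![delete _ _ _]ffunE off // eq_sym neq_lift.
  by rewrite negbK => /eqP.
have telescope k : (k <= n)%N -> y j (h 0%N) = y j (h k).
  by elim: k => // k IHk kn; rewrite -step // IHk // ltnW.
by rewrite -h0 -hn (telescope n).
Qed.

(** Inserting the same value at [j] preserves agreement on the units that interfere with [j], so
    both outcomes in [tau] are unchanged. *)
Lemma tau_eq j z z' :
  (forall i, interferes y i j -> z i = z' i) ->
  tau y j (delete j z) = tau y j (delete j z').
Proof.
move=> zz'; rewrite /tau; congr (_ - _); apply: outcome_eq => i Iij;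
  by rewrite !insert_delete zz'.
Qed.

Variable ktau : R.
Hypothesis tau_le : forall i w, `|tau y i w| <= ktau.

Lemma tau_dist j z z' :
  `|tau y j (delete j z) - tau y j (delete j z')|
    <= 2 * ktau * \sum_i (interferes y i j)%:R * `|(z i)%:R - (z' i)%:R|.
Proof.
have ktau0 : 0 <= ktau by apply: le_trans (tau_le j (delete j z)).
have [/existsP[i /andP[Iij zi]]|] :=
    boolP [exists i, interferes y i j && (z i != z' i)]; last first.
  rewrite negb_exists => /forallP zz'.
  rewrite (@tau_eq j z z') => [|i Iij].
    rewrite subrr normr0 !mulr_ge0 //.
    by apply: sumr_ge0 => i _; rewrite mulr_ge0.
  by have := zz' i; rewrite Iij /= negbK => /eqP.
have dist_le : `|tau y j (delete j z) - tau y j (delete j z')| <= 2 * ktau.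
  apply: le_trans (ler_normB _ _) _.
  by rewrite mulr_natl mulr2n lerD.
(* One flipped interfering unit [i] suffices: its summand equals 1 and the others are
   nonnegative. *)
apply: le_trans dist_le _; rewrite ler_peMr ?mulr_ge0 // (bigD1 i) //= Iij mul1r.
have -> : `|(z i)%:R - (z' i)%:R| = 1 :> R.
  by case: (z i) (z' i) zi => [] [] // _; rewrite ?subr0 ?sub0r ?normrN normr1.
by rewrite lerDl; apply: sumr_ge0 => k _; rewrite mulr_ge0.
Qed.

Lemma tauATE_dist z z' :
  `|tauATE y z - tauATE y z'|
    <= 2 * ktau * (n%:R^-1 *
       \sum_i (outdeg y i)%:R * `|(z i)%:R - (z' i)%:R|).
Proof.
rewrite /tauATE -mulrBr -sumrB normrM ger0_norm ?invr_ge0 // mulrCA.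
apply: ler_wpM2l; first by rewrite invr_ge0.
apply: le_trans (ler_norm_sum _ _ _) _.
apply: le_trans (ler_sum _ (fun j _ => tau_dist j z z')) _.
(* With the sum over [j] innermost, the indicators for fixed [i] add up to [outdeg y i]. *)
rewrite -mulr_sumr exchange_big /=.
under eq_bigr do rewrite -mulr_suml -natr_sum.
exact: lexx.
Qed.

Hypothesis n_gt0 : (0 < n)%N.

(** For [r = 1] each out-degree is bounded by the maximum. For [r > 1] this is Hoelder with
    exponents [r / (r - 1)] and [r]. *)
Lemma outdeg_hoelder (r : R) (x : 'I_n -> R) : 1 <= r ->
  n%:R^-1 * \sum_i (outdeg y i)%:R * `|x i|
    <= n%:R `^ (- r^-1) * Cconj y r * lnorm r x.
Proof.
rewrite /Cconj /lnorm; case: eqVneq => [-> _|r1 r_ge1].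
  have x0 : 0 <= \sum_i `|x i| by apply: sumr_ge0.
  under [X in _ <= _ * X `^ _]eq_bigr do rewrite powRr1 //.
  rewrite invr1 powR_inv1 // powRr1 // -mulrA ler_wpM2l ?invr_ge0 // mulr_sumr.
  apply: ler_sum => i _; rewrite ler_wpM2r // ler_nat.
  exact: (leq_bigmax (F := outdeg y)).
have r_gt1 : 1 < r by rewrite lt_def r1.
have r_gt0 : 0 < r by apply: lt_trans r_gt1.
have r'_gt0 : 0 < r / (r - 1) by rewrite divr_gt0 // subr_gt0.
have conj : (r / (r - 1))^-1 + r^-1 = 1.
  by rewrite invfM invrK mulrBr mulVf ?gt_eqF // mulr1 subrK.
rewrite /Cmean powRM ?invr_ge0 //; last first.
  by apply: sumr_ge0 => i _; exact: powR_ge0.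
(* The averaging factor inside [Cmean] comes out as [n] to the power [- (r / (r - 1))^-1]. Together
   with [- r^-1] the exponents add up to -1, matching the factor on the left. *)
rewrite -(powR_inv1 (ler0n R n)) -powRrM mulN1r mulrA -powRD; last first.
  by rewrite pnatr_eq0 -lt0n n_gt0 implybT.
rewrite -opprD [r^-1 + _]addrC conj -mulrA ler_wpM2l ?powR_ge0 //.
have := finite_hoelder _ _ (fun i => (outdeg y i)%:R) x r'_gt0 r_gt0 conj.
by under eq_bigr do rewrite normr_nat; under [X in X `^ _ * _]eq_bigr do
  rewrite normr_nat.
Qed.

Lemma Cconj_ge0 (r : R) : 0 <= Cconj y r.
Proof. by rewrite /Cconj; case: ifP => _; rewrite ?powR_ge0. Qed.

End Interference.

Theorem proposition13 (R : realType) (n : nat) (n_gt0 : (0 < n)%N)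
    (y : outcomes R n) (P Q : distr R (assignment n)) (ktau : R)
    (tau_le : forall (i : 'I_n) (w : assignment n.-1), `|tau y i w| <= ktau)
    (r : R) (r_ge1 : 1 <= r) :
  `|tauEATE y P - tauEATE y Q|
    <= 2 * ktau * n%:R `^ (- r^-1) * Cconj y r * Wasserstein r P Q.
Proof.
have ktau0 : 0 <= ktau.
  (* Since [n > 0] there is a unit 0 at which the bound can be read; the assignment is arbitrary. *)
  exact: le_trans (normr_ge0 _) (tau_le (Ordinal n_gt0) [ffun=> true]).
apply: Wasserstein_lipschitz => [|z z'].
  by rewrite !mulr_ge0 ?powR_ge0 ?Cconj_ge0.
apply: le_trans (tauATE_dist _ _ tau_le z z') _.
by rewrite -!mulrA !ler_wpM2l // !mulrA outdeg_hoelder.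
Qed.
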